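(* Let $\mathbb K$ be a finite field or an algebraically closed field, and let $Y$ be a subset of $T_X$. Then the following are equivalent: (1) $Y$ is a finite submonoid of $T_X$. (2) $Y=Y_{Q,H}$ for some finite submonoid $H$ of $\mathbb K^*$ and some integer matrix $Q$ with $r$ columns (of size $s\times r$ for some $s$).
   Context: Setting. $X$ is a complete simplicial toric variety over a field $\mathbb K$ given by a fan $\Sigma\subset\mathbb R^n$ with rays $\rho_1,\dots,\rho_r$ and corresponding primitive lattice generators $\mathbf v_1,\dots,\mathbf v_r\in\mathbb Z^n$. The matrix $\phi:\mathbb Z^n\to\mathbb Z^r$ has rows $\mathbf v_1,\dots,\mathbf v_r$, and there is an exact sequence $0\to\mathbb Z^n\xrightarrow{\phi}\mathbb Z^r\xrightarrow{\beta}\mathcal A\to 0$ with $\mathcal A\cong \mathrm{Cl}(X)$. Let $\mathbf u_1,\dots,\mathbf u_n\in\mathbb Z^r$ be the columns of $\phi$, write $\mathbf t^{\mathbf u}=t_1^{u_1}\cdots t_r^{u_r}$, let $\pi:(\mathbb K^* )^r\to T_X\cong(\mathbb K^* )^n$, $\pi(\mathbf t)=(\mathbf t^{\mathbf u_1},\dots,\mathbf t^{\mathbf u_n})$, and $G=\ker\pi$. The torus $T_X$ is split and $1\to G\to(\mathbb K^* )^r\xrightarrow{\pi}T_X\to1$ is assumed exact, so $T_X=(\mathbb K^* )^r/G$; the order of the torsion part of $\mathcal A$ is assumed coprime to the characteristic of $\mathbb K$. For $P=(p_1,\dots,p_r)\in(\mathbb K^* )^r$, $[P]=[p_1:\cdots:p_r]=G\cdot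 P$ denotes its class in $T_X$, and the group law is $[P][P']=[PP']$ (coordinatewise), with identity $[1]=[1:\cdots:1]$. For a subset $H\subseteq\mathbb K^*$ and an $s\times r$ integer matrix $Q=(q_{ij})$, the parameterized set is $$Y_{Q,H}=\{[t_1^{q_{11}}\cdots t_s^{q_{s1}}:\cdots:t_1^{q_{1r}}\cdots t_s^{q_{sr}}] : t_1,\dots,t_s\in H\}\subseteq T_X.$$ *)

(* Defs.v *)
From HB Require Import structures.
From mathcomp Require Import all_boot all_order all_algebra.
From mathcomp Require Import all_classical all_reals.
Set Implicit Arguments.
Unset Strict Implicit.
Unset Printing Implicit Defensive.
Import Order.TTheory GRing.Theory Num.Theory.
Local Open Scope classical_set_scope.
Local Open Scope ring_scope.

(* R^n is 'rV[R]_n; linear forms on R^n are column vectors m, with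
   pairing (x *m m) 0 0. *)
Section Fans.
Context {R : realType} {n : nat}.
Implicit Types (sigma tau rho : set 'rV[R]_n) (Sigma : set (set 'rV[R]_n)).

(* generated by the rows of W; the zero cone when k = 0 *)
Definition cone k (W : 'M[R]_(k, n)) : set 'rV[R]_n :=
  [set c *m W | c in [set c : 'rV[R]_k | forall i, 0 <= c 0 i]].

Definition rational_cone sigma :=
  exists k (W : 'M[int]_(k, n)), sigma = cone (map_mx intr W).

Definition strongly_convex sigma :=
  forall x, sigma x -> sigma (- x) -> x = 0.

Definition face tau sigma :=
  exists2 m : 'cV[R]_n, (forall x, sigma x -> 0 <= (x *m m) 0 0)
    & tau = [set x | sigma x /\ (x *m m) 0 0 = 0].

Record is_fan Sigma : Prop := IsFan {
  fan_finite : finite_set Sigma;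
  fan_rational : forall sigma, Sigma sigma -> rational_cone sigma;
  fan_strongly_convex : forall sigma, Sigma sigma -> strongly_convex sigma;
  fan_face : forall sigma tau, Sigma sigma -> face tau sigma -> Sigma tau;
  fan_meet : forall sigma tau, Sigma sigma -> Sigma tau ->
    face (sigma `&` tau) sigma /\ face (sigma `&` tau) tau
}.

Definition complete_fan Sigma := \bigcup_(sigma in Sigma) sigma = setT.

Definition simplicial_cone sigma :=
  exists k (W : 'M[R]_(k, n)), row_free W /\ sigma = cone W.

Definition simplicial_fan Sigma :=
  forall sigma, Sigma sigma -> simplicial_cone sigma.

(* A one-dimensional strongly convex cone is exactly a half-line from 0. *)
Definition ray rho := exists2 w : 'rV[R]_n, w != 0 & rho = cone w.

End Fans.

Definition primitive n (v : 'rV[int]_n) :=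
  \big[gcdn/0%N]_(j < n) `|v ord0 j|%N = 1%N.

(* The rows of phi list, without repetition, the primitive generators of the
   rays of Sigma. *)
Record ray_generators (R : realType) n r (Sigma : set (set 'rV[R]_n))
    (phi : 'M[int]_(r, n)) : Prop := RayGenerators {
  ray_primitive : forall i, primitive (row i phi);
  ray_inj : injective (fun i => cone (map_mx (intr : int -> R) (row i phi)));
  ray_range : range (fun i => cone (map_mx (intr : int -> R) (row i phi)))
              = Sigma `&` ray
}.

(* 0 -> Z^n -> Z^r -> A -> 0 is exact; phi acts on column vectors. *)
Record class_group_sequence n r (phi : 'M[int]_(r, n)) (A : zmodType)
    (beta : {additive 'cV[int]_r -> A}) : Prop := ClassGroupSequence {
  cgs_inj : injective (fun m : 'cV[int]_n => phi *m m);
  cgs_exact : range (fun m : 'cV[int]_n => phi *m m) = [set a | beta a = 0];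
  cgs_surj : range beta = setT
}.

Definition torsion (A : zmodType) : set A :=
  [set a | exists2 m : nat, (0 < m)%N & a *+ m = 0].
Arguments torsion : clear implicits.

(* No condition on the order in characteristic 0. *)
Definition torsion_order_coprime_pchar (A : zmodType) (K : fieldType) :=
  exists2 N : nat, (torsion A #= `I_N)%card
    & forall p, p \in [pchar K] -> coprime N p.

Section Kstar.
Variable K : fieldType.

Definition Kstar : Type := {x : K | x != 0}.
HB.instance Definition _ := SubChoice.on Kstar.

Definition Kone : Kstar := Sub 1 (oner_neq0 K).
Definition Kmul (x y : Kstar) : Kstar :=
  Sub (val x * val y) (mulf_neq0 (valP x) (valP y)).
Definition Kinv (x : Kstar) : Kstar := Sub (val x)^-1 (invr_neq0 (valP x)).

Fact KmulA : associative Kmul.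
Proof. by move=> x y z; apply: val_inj; rewrite /= mulrA. Qed.
Fact Kmul1 : left_id Kone Kmul.
Proof. by move=> x; apply: val_inj; rewrite /= mul1r. Qed.
Fact Kmulx1 : right_id Kone Kmul.
Proof. by move=> x; apply: val_inj; rewrite /= mulr1. Qed.
Fact KmulV : left_inverse Kone Kinv Kmul.
Proof. by move=> x; apply: val_inj; rewrite /= mulVf // (valP x). Qed.
Fact KmulxV : right_inverse Kone Kinv Kmul.
Proof. by move=> x; apply: val_inj; rewrite /= mulfV // (valP x). Qed.

HB.instance Definition _ := isGroup.Build Kstar KmulA Kmul1 Kmulx1 KmulV KmulxV.

(* (K^* )^m, with the coordinatewise group structure of finite functions *)
Definition torus (m : nat) : Type := {ffun 'I_m -> Kstar}.
HB.instance Definition _ m := Group.on (torus m).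

Fact monomial_neq0 s (t : torus s) (u : 'cV[int]_s) :
  \prod_(i < s) val (t i) ^ u i 0 != 0.
Proof. by apply/prodf_neq0 => i _; exact: expfz_neq0 (valP (t i)). Qed.

Definition monomial s (t : torus s) (u : 'cV[int]_s) : Kstar :=
  Sub (\prod_(i < s) val (t i) ^ u i 0) (monomial_neq0 t u).

Definition monomial_map s m (Q : 'M[int]_(s, m)) (t : torus s) : torus m :=
  [ffun j => monomial t (col j Q)].

Fact monomial_mapM s m (Q : 'M[int]_(s, m)) :
  {morph monomial_map Q : t t' / (t * t')%g}.
Proof.
move=> t t'; apply/ffunP => j; apply: val_inj; rewrite !ffunE /= -big_split.
by apply: eq_bigr => i _; rewrite ffunE expfzMl.
Qed.

Fact torus_mulC m (t t' : torus m) : (t * t')%g = (t' * t)%g.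
Proof. by apply/ffunP => i; apply: val_inj; rewrite !ffunE /= mulrC. Qed.

End Kstar.

Section ToricTorus.
Variables (K : fieldType) (n r : nat) (phi : 'M[int]_(r, n)).

Definition Gker : {pred torus K r} := [pred t | monomial_map phi t == 1%g].

Definition same_orbit : rel (torus K r) := fun P P' => (P' / P)%g \in Gker.

Fact same_orbitE P P' :
  same_orbit P P' = (monomial_map phi P == monomial_map phi P').
Proof.
rewrite /same_orbit inE -(inj_eq (mulIg (monomial_map phi P))).
by rewrite -monomial_mapM mulgVK mul1g eq_sym.
Qed.

Fact same_orbit_refl : reflexive same_orbit.
Proof. by move=> P; rewrite same_orbitE. Qed.
Fact same_orbit_sym : symmetric same_orbit.
Proof. by move=> P P'; rewrite !same_orbitE eq_sym. Qed.
Fact same_orbit_trans : transitive same_orbit.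
Proof. by move=> P2 P1 P3; rewrite !same_orbitE => /eqP -> /eqP ->. Qed.

Canonical same_orbit_equiv :=
  EquivRel same_orbit same_orbit_refl same_orbit_sym same_orbit_trans.

Definition TX : Type := {eq_quot same_orbit}%qT.
HB.instance Definition _ := Choice.on TX.
HB.instance Definition _ := EqQuotient.on TX.

Definition torus_class (P : torus K r) : TX := (\pi_TX P)%qT.

Definition TXone : TX := torus_class 1%g.
Definition TXmul (x y : TX) : TX := torus_class (repr x * repr y)%g.
Definition TXinv (x : TX) : TX := torus_class (repr x)^-1%g.

Fact torus_classP P P' :
  reflect (torus_class P = torus_class P')
          (monomial_map phi P == monomial_map phi P').
Proof. by rewrite -same_orbitE; exact: eqmodP. Qed.

Fact repr_classE P :
  monomial_map phi (repr (torus_class P)) = monomial_map phi P.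
Proof. by apply/eqP/torus_classP; rewrite /torus_class reprK. Qed.

Fact TXmulE P P' :
  TXmul (torus_class P) (torus_class P') = torus_class (P * P')%g.
Proof. by apply/torus_classP; rewrite !monomial_mapM !repr_classE. Qed.

Fact torus_classK (x : TX) : torus_class (repr x) = x.
Proof. exact: reprK. Qed.

Fact TXmulA : associative TXmul.
Proof.
by move=> x y z; rewrite -[x]torus_classK -[y]torus_classK -[z]torus_classK
  !TXmulE mulgA.
Qed.
Fact TXmul1 : left_id TXone TXmul.
Proof. by move=> x; rewrite -[x]torus_classK TXmulE mul1g. Qed.
Fact TXmulx1 : right_id TXone TXmul.
Proof. by move=> x; rewrite -[x]torus_classK TXmulE mulg1. Qed.
Fact TXmulV : left_inverse TXone TXinv TXmul.
Proof. by move=> x; rewrite -[X in TXmul _ X]torus_classK TXmulE mulVg. Qed.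
Fact TXmulxV : right_inverse TXone TXinv TXmul.
Proof. by move=> x; rewrite -[X in TXmul X _]torus_classK TXmulE mulgV. Qed.

HB.instance Definition _ := isGroup.Build TX TXmulA TXmul1 TXmulx1 TXmulV TXmulxV.

Definition parameterized_set s (Q : 'M[int]_(s, r)) (H : set (Kstar K)) :
    set TX :=
  [set torus_class (monomial_map Q t) | t in
    [set t : torus K s | forall k, H (t k)]].

End ToricTorus.
Arguments parameterized_set {K n r} phi {s} Q H.

Definition finite_submonoid (M : monoidType) (Y : set M) : Prop :=
  finite_set Y /\ monoid_closed [in Y].

(* Main.v *)
Require Import Defs.
From mathcomp Require Import all_boot all_order all_algebra.
From mathcomp Require Import all_classical all_reals.
Import GRing.Theory.
Local Open Scope classical_set_scope.
Local Open Scope ring_scope.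

(** Any set [Y_{Q,H}] is the image of the finite monoid [H^s] under a monoid
    morphism, hence a finite submonoid.  The substance is the converse.

    A finite submonoid [Y] of the group [T_X] consists of torsion elements.
    Suppose that each [y] in [Y] has a representative [P_y] in [(K^* )^r] all
    of whose coordinates are roots of unity.  Finitely many roots of unity in a
    field are powers of a single primitive [N]-th root of unity [h]
    ([common_primitive_root]), so [P_y] is [(h^q_{y1}, ..., h^q_{yr})] for
    integers [q_{yj}].  Take for [Q] the matrix [(q_{yj})], with one row per
    element of [Y], and for [H] the group of [N]-th roots of unity.  With
    [t_y = h^a_y], the point of [Y_{Q,H}] with parameter [t] is the product of
    the [y^a_y]; such products lie in [Y] because [Y] is a submonoid, and each
    [y] is reached by letting [t_y = h] and all other parameters be [1].

    It remains to lift torsion elements of [T_X] to torsion elements of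
    [(K^* )^r] ([torsion_representative]).  Over a finite field all of [K^*] is
    torsion.  Over an algebraically closed field, injectivity of [phi] gives an
    integer matrix [L] with [L phi = d I] for some [d > 0]
    ([left_inverse_up_to_scalar]).  If [z] is the torsion point
    [monomial_map phi P] and [w^d = z], then [w] is torsion, and so is its image
    under [monomial_map L], which [monomial_map phi] sends to [w^d = z]: it is
    a torsion point in the class of [P]. *)

(** * Roots of unity in a field *)

Lemma prim_root_mul_coprime (F : fieldType) (a b : nat) (x y : F) :
  a.-primitive_root x -> b.-primitive_root y -> coprime a b ->
  (a * b).-primitive_root (x * y).
Proof.
move=> px py cab.
have ab_gt0 : (0 < a * b)%N by rewrite muln_gt0 !(prim_order_gt0 px, prim_order_gt0 py).
have [|m pm mab] := @prim_order_exists _ _ (x * y) ab_gt0.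
  by rewrite exprMn exprM (prim_expr_order px) expr1n mulnC exprM
    (prim_expr_order py) expr1n mulr1.
suff -> : (a * b)%N = m by [].
apply/eqP; rewrite eqn_dvd mab andbT Gauss_dvd //; apply/andP.
have xym : x ^+ m * y ^+ m = 1 by rewrite -exprMn (prim_expr_order pm).
have xyk k : x ^+ (m * k) * y ^+ (m * k) = 1.
  by rewrite !exprM -exprMn xym expr1n.
split.
  rewrite -(@Gauss_dvdl a m b) // (prim_order_dvd px); apply/eqP.
  by rewrite -[LHS]mulr1 -[RHS](xyk b) [in y ^+ _]mulnC [y ^+ _]exprM
    (prim_expr_order py) expr1n.
rewrite -(@Gauss_dvdl b m a) 1?coprime_sym // (prim_order_dvd py); apply/eqP.
by rewrite -[LHS]mul1r -[RHS](xyk a) [in x ^+ _]mulnC [x ^+ _]exprM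
  (prim_expr_order px) expr1n.
Qed.

(** Each prime power of [lcmn a b] is taken from the one of [a] and [b] in which
    the prime has the larger exponent, ties going to [a]; the two shares are
    therefore coprime. *)
Lemma lcmn_dvd_coprime_mul (a b : nat) : (0 < a)%N -> (0 < b)%N ->
  exists a' b', [/\ (a' %| a)%N, (b' %| b)%N, coprime a' b' & (lcmn a b %| a' * b')%N].
Proof.
move=> a0 b0; pose pi : nat_pred := [pred p | (logn p b <= logn p a)%N].
exists (a`_pi)%N, (b`_(pi^'))%N; split; rewrite ?dvdn_part //.
  exact: coprime_partC.
have part_dvd (rho : nat_pred) p c : p \in rho -> (c`_p %| c`_rho)%N.
  by move=> prho; rewrite -(@partn_part p rho) ?dvdn_part // => q /eqnP->.
rewrite dvdn_lcm; apply/andP; split; apply/dvdn_partP => // p _;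
  have [ppi|ppi] := boolP (p \in pi).
- by rewrite dvdn_mulr ?part_dvd.
- apply: dvdn_mull; apply: dvdn_trans _ (part_dvd pi^' p b ppi).
  by rewrite !p_part dvdn_exp2l // ltnW // ltnNge.
- apply: dvdn_mulr; apply: dvdn_trans _ (part_dvd pi p a ppi).
  by rewrite !p_part dvdn_exp2l.
- by rewrite dvdn_mull ?part_dvd.
Qed.

(** By induction: if [x] has order [a] and [h] has order [N], suitable powers
    of [x] and [h] have coprime orders whose product is a multiple of [a] and
    of [N]; their product replaces [h]. *)
Lemma common_primitive_root (F : fieldType) (s : seq F) :
  (forall x, x \in s -> exists2 m, (0 < m)%N & x ^+ m = 1) ->
  exists (N : nat) (h : F),
    N.-primitive_root h /\ forall x, x \in s -> x ^+ N = 1.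
Proof.
elim: s => [_|x s IHs xs_tors].
  by have [N pN _] := prim_order_exists (ltn0Sn 0) (expr1n F 1); exists N, 1.
have [N [h [ph sN]]] : exists (N : nat) (h : F),
    N.-primitive_root h /\ forall x, x \in s -> x ^+ N = 1.
  by apply: IHs => y ys; apply: xs_tors; rewrite inE ys orbT.
have [|m m_gt0 xm] := xs_tors x; first exact: mem_head.
have [a pa _] := prim_order_exists m_gt0 xm.
have [a' [b' [a'a b'N cab]]] :=
  lcmn_dvd_coprime_mul _ _ (prim_order_gt0 pa) (prim_order_gt0 ph).
rewrite dvdn_lcm => /andP[/dvdnP[k ab_a] /dvdnP[l ab_N]].
exists (a' * b')%N, (x ^+ (a %/ a') * h ^+ (N %/ b')); split.
  by apply: prim_root_mul_coprime; rewrite ?dvdn_prim_root.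
move=> y; rewrite inE => /predU1P[->|/sN yN].
  by rewrite ab_a mulnC exprM (prim_expr_order pa) expr1n.
by rewrite ab_N mulnC exprM yN expr1n.
Qed.

Lemma closed_field_root (F : fieldType) (d : nat) (x : F) :
  GRing.closed_field_axiom F -> (0 < d)%N -> exists w : F, w ^+ d = x.
Proof.
case: d => // d closedF _.
have [w wE] := closedF d.+1 (fun i => if i == 0%N then x else 0) isT.
exists w; rewrite wE big_ord_recl /= mulr1 big1 ?addr0 // => i _.
by rewrite mul0r.
Qed.

Lemma val_Kstar_expg (F : fieldType) (x : Kstar F) k :
  val (x ^+ k)%g = val x ^+ k.
Proof. by elim: k => // k IHk; rewrite expgS exprS -IHk. Qed.

(** A primitive root makes this group cyclic, which yields finiteness. *)
Lemma roots_of_unity_finite_submonoid (F : fieldType) N (h : Kstar F) :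
  N.-primitive_root (val h) ->
  finite_submonoid [set x : Kstar F | val x ^+ N = 1].
Proof.
move=> prim_h; split; last first.
  split=> [|x y /set_mem xN /set_mem yN]; apply/mem_set; rewrite /= ?expr1n //.
  by rewrite exprMn xN yN mulr1.
have fin_powers : finite_set [set (h ^+ val i)%g | i in [set: 'I_N]].
  exact/finite_image/finite_finset.
apply: sub_finite_set fin_powers => x /(prim_rootP prim_h)[i xi].
by exists i => //; apply: val_inj; rewrite val_Kstar_expg.
Qed.

(** * Integer matrices *)

Lemma clear_denominators (m n : nat) (M : 'M[rat]_(m, n)) :
  exists (d : nat) (B : 'M[int]_(m, n)),
    (0 < d)%N /\ map_mx intr B = d%:R *: M.
Proof.
pose d := (\prod_i \prod_j `|denq (M i j)|)%N.
exists d, (\matrix_(i, j) ((d %/ `|denq (M i j)|)%N%:Z * numq (M i j))).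
split.
  by rewrite /d !prodn_gt0 // => i; rewrite prodn_gt0 // => j; rewrite absz_gt0 denq_neq0.
apply/matrixP => i j; rewrite !mxE rmorphM /= -pmulrn.
have dv : (`|denq (M i j)| %| d)%N.
  by rewrite /d (bigD1 i) //= (bigD1 j) //= -mulnA dvdn_mulr.
rewrite -[in RHS](divnK dv) natrM -mulrA; congr (_ * _).
by rewrite [in RHS]mulrC numqE -[in LHS]absz_denq -pmulrn.
Qed.

(** An integer kernel vector arises from a rational one by clearing
    denominators, so [phi] also has full column rank over the rationals;
    clearing the denominators of a rational left inverse gives [L]. *)
Lemma left_inverse_up_to_scalar (r n : nat) (phi : 'M[int]_(r, n)) :
  injective (fun m : 'cV[int]_n => phi *m m) ->
  exists (d : nat) (L : 'M[int]_(n, r)), (0 < d)%N /\ L *m phi = d%:R%:M.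
Proof.
move=> inj_phi; have intr_mx_inj k l :
    injective (map_mx intr : 'M[int]_(k, l) -> 'M[rat]_(k, l)).
  by move=> M N /matrixP MN; apply/matrixP => i j; have := MN i j; rewrite !mxE => /intr_inj.
pose F := map_mx (intr : int -> rat) phi.
have /row_freeP[C FC] : row_free F^T.
  apply: inj_row_free => v vF.
  have [d [B [d_gt0 dB]]] := clear_denominators _ _ v.
  have B0 : B = 0.
    apply: trmx_inj; apply: inj_phi; rewrite trmx0 mulmx0; apply: trmx_inj.
    apply: intr_mx_inj.
    rewrite trmx_mul trmxK map_mxM -map_trmx dB -/F -scalemxAl vF scaler0.
    by rewrite trmx0 map_mx0.
  move/eqP: dB; rewrite B0 map_mx0 eq_sym scaler_eq0 Num.Theory.pnatr_eq0.
  by rewrite -leqn0 leqNgt d_gt0 => /eqP.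
have [d [L [d_gt0 dL]]] := clear_denominators _ _ C^T.
exists d, L; split=> //; apply: intr_mx_inj.
by rewrite map_mxM dL -/F -scalemxAl -[F]trmxK -trmx_mul FC trmx1 map_scalar_mx
  rmorph_nat scalemx1.
Qed.

(** * Torsion in finite submonoids *)

Lemma submonoid_expg (M : monoidType) (Y : set M) (y : M) k :
  monoid_closed [in Y] -> Y y -> Y (y ^+ k)%g.
Proof.
move=> [Y1 YM] Yy; elim: k => [|k IHk]; first by rewrite expg0; exact/set_mem.
by rewrite expgS; apply/set_mem/YM; exact/mem_set.
Qed.

(** The powers of [y] stay in the finite set [Y], so two of them coincide,
    and cancellation in the group applies. *)
Lemma finite_submonoid_torsion (M : groupType) (Y : set M) (y : M) :
  finite_submonoid Y -> Y y -> exists2 m, (0 < m)%N & (y ^+ m)%g = 1%g.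
Proof.
move=> [finY closedY] Yy.
have Yexp k : Y (y ^+ k)%g by exact: submonoid_expg.
have [inj_exp|] := pselect (injective (fun k => (y ^+ k)%g)).
  case: infinite_nat.
  have -> : [set: nat] = (fun k => (y ^+ k)%g) @^-1` Y.
    by apply/seteqP; split=> // k _; exact: Yexp.
  by apply: finite_preimage finY => i j _ _; exact: inj_exp.
move=> /existsNP[i /existsNP[j /not_implyP[eij /eqP]]].
wlog lt_ij : i j eij / (i < j)%N.
  move=> wl neq_ij; have := neq_ij; rewrite neq_ltn => /orP[] lt_ij.
    exact: wl eij lt_ij neq_ij.
  by apply: (wl j i) => //; rewrite eq_sym.
move=> _; exists (j - i)%N; first by rewrite subn_gt0.
by rewrite expgnFr 1?ltnW // -eij mulgV.
Qed.

(** * Monomial maps *)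

Lemma torus_expgE (F : fieldType) m (t : torus F m) k j :
  val ((t ^+ k)%g j) = val (t j) ^+ k.
Proof. by elim: k => [|k IHk]; rewrite ?ffunE // expgS exprS -IHk ffunE. Qed.

Lemma torus_prodE (F : fieldType) m (I : Type) (s : seq I) (X : I -> torus F m) j :
  val ((\prod_(i <- s) X i)%g j) = \prod_(i <- s) val (X i j).
Proof.
by elim/big_ind2: _ => [|x a y b <- <-|//]; rewrite ffunE.
Qed.

(** Together with [monomial_map_scalar], this turns a matrix relation
    [L phi = d I] into the statement that applying the monomial maps of [L] and
    then of [phi] raises every point of the torus to the power [d]. *)
Lemma monomial_map_comp (F : fieldType) a b c (Q : 'M[int]_(a, b))
    (S : 'M[int]_(b, c)) (t : torus F a) :
  monomial_map S (monomial_map Q t) = monomial_map (Q *m S) t.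
Proof.
apply/ffunP => j; apply: val_inj; rewrite !ffunE /=.
transitivity (\prod_(k < b) \prod_(i < a) val (t i) ^ (Q i k * S k j)).
  apply: eq_bigr => k _; rewrite !mxE ffunE /=.
  rewrite (big_morph (fun x => x ^ S k j) (fun x y => expfzMl x y _) (exp1rz F _)).
  by apply: eq_bigr => i _; rewrite mxE exprzAC exprz_exp mulrC.
rewrite exchange_big; apply: eq_bigr => i _ /=; rewrite !mxE.
have ti_unit : val (t i) \is a GRing.unit by rewrite unitfE (valP (t i)).
by rewrite (big_morph (fun e => val (t i) ^ e) (exprzDr ti_unit) (expr0z _)).
Qed.

Lemma monomial_map1 (F : fieldType) a b (Q : 'M[int]_(a, b)) :
  monomial_map Q 1%g = 1%g :> torus F b.
Proof. by apply: (mulgI (monomial_map Q 1%g)); rewrite -monomial_mapM !mulg1. Qed.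

Lemma monomial_mapX (F : fieldType) a b (Q : 'M[int]_(a, b)) (t : torus F a) k :
  monomial_map Q (t ^+ k)%g = (monomial_map Q t ^+ k)%g.
Proof.
by elim: k => [|k IHk]; rewrite ?monomial_map1 // !expgS monomial_mapM IHk.
Qed.

Lemma monomial_map_scalar (F : fieldType) a d (t : torus F a) :
  monomial_map (d%:R%:M : 'M[int]_a) t = (t ^+ d)%g.
Proof.
apply/ffunP => j; apply: val_inj; rewrite torus_expgE ffunE /=.
rewrite (bigD1 j) //= big1 => [|i ij]; rewrite !mxE ?(negPf ij) //.
by rewrite eqxx mulr1n mulr1 exprnP natz.
Qed.

(** * Torsion points of the toric variety's torus *)

Section ToricTorusLemmas.
Variables (K : fieldType) (n r : nat) (phi : 'M[int]_(r, n)).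

Lemma torus_classM (P P' : torus K r) :
  torus_class phi (P * P')%g = (torus_class phi P * torus_class phi P')%g.
Proof. by rewrite -TXmulE. Qed.

Lemma torus_classX (P : torus K r) k :
  torus_class phi (P ^+ k)%g = (torus_class phi P ^+ k)%g.
Proof. by elim: k => // k IHk; rewrite !expgS torus_classM IHk. Qed.

(** An arbitrary representative need not be torsion, since [Gker] is in
    general infinite; extracting [d]-th roots in the torus of dimension [n],
    where the image of [y] has finite order, produces one that is. *)
Lemma closed_torsion_representative (y : TX K phi) m :
  GRing.closed_field_axiom K -> injective (fun v : 'cV[int]_n => phi *m v) ->
  (0 < m)%N -> (y ^+ m)%g = 1%g ->
  exists (P : torus K r) (N : nat),
    [/\ torus_class phi P = y, (0 < N)%N & (P ^+ N)%g = 1%g].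
Proof.
move=> closedK /left_inverse_up_to_scalar[d [L [d_gt0 Lphi]]] m_gt0.
(* [z] is the image of [y] under the embedding of the quotient into (K^* )^n. *)
rewrite -[y]torus_classK -torus_classX => /torus_classP/eqP.
rewrite monomial_mapX monomial_map1; set z := monomial_map phi _ => zm.
have /choice[f fE] : forall i, exists w : Kstar K, (w ^+ d)%g = z i.
  move=> i; have [w wd] := closed_field_root _ _ (val (z i)) closedK d_gt0.
  have w_neq0 : w != 0.
    apply: contraNneq (valP (z i)) => w0.
    by rewrite -wd w0 expr0n -(prednK d_gt0).
  by exists (Sub w w_neq0); apply: val_inj; rewrite val_Kstar_expg.
pose w : torus K n := [ffun i => f i].
have wd : (w ^+ d)%g = z.
  apply/ffunP => i; apply: val_inj.
  by rewrite torus_expgE ffunE -val_Kstar_expg fE.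
exists (monomial_map L w), (d * m)%N; split; last 1 first.
- by rewrite -monomial_mapX expgnA wd zm monomial_map1.
- by apply/torus_classP; rewrite monomial_map_comp Lphi monomial_map_scalar wd.
by rewrite muln_gt0 d_gt0.
Qed.

Lemma finite_torsion_unit (x : Kstar K) :
  finite_set [set: K] -> exists2 m, (0 < m)%N & val x ^+ m = 1.
Proof.
move=> finK; have [| |m m_gt0 xm] := @finite_submonoid_torsion (Kstar K) setT x.
- split; last by split=> [|? ? _ _]; rewrite in_setT.
  have -> : [set: Kstar K] = val @^-1` [set: K] by [].
  by apply: finite_preimage finK => ? ? _ _; exact: val_inj.
- by [].
by exists m; rewrite // -val_Kstar_expg xm.
Qed.

Lemma torsion_representative (Y : set (TX K phi)) (y : TX K phi) :
  finite_set [set: K] \/ GRing.closed_field_axiom K ->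
  injective (fun v : 'cV[int]_n => phi *m v) ->
  finite_submonoid Y -> Y y ->
  exists P : torus K r, torus_class phi P = y /\
    forall j, exists2 m, (0 < m)%N & val (P j) ^+ m = 1.
Proof.
move=> hK inj_phi subY Yy; have [m m_gt0 ym] := finite_submonoid_torsion _ _ _ subY Yy.
case: hK => [finK|closedK].
  (* Every representative works: K^* itself is finite. *)
  exists (repr y); split; first exact: torus_classK.
  by move=> j; exact: finite_torsion_unit.
have [P [N [Py N_gt0 PN]]] :=
  closed_torsion_representative _ _ closedK inj_phi m_gt0 ym.
exists P; split=> // j; exists N => //.
by rewrite -torus_expgE PN ffunE.
Qed.

(** * Parameterized sets *)

Lemma finite_torus_box s (H : set (Kstar K)) :
  finite_set H -> finite_set [set t : torus K s | forall k, H (t k)].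
Proof.
move=> /finite_seqP[l ->].
pose f (g : {ffun 'I_s -> 'I_(size l)}) : torus K s :=
  [ffun k => nth 1%g l (g k)].
apply: (@sub_finite_set _ _ (f @` setT)); last exact/finite_image/finite_finset.
move=> t /= tl; have lt_index k : (index (t k) l < size l)%N.
  by rewrite index_mem tl.
exists [ffun k => Ordinal (lt_index k)] => //.
by apply/ffunP => k; rewrite !ffunE /= nth_index ?tl.
Qed.

Lemma parameterized_set_finite_submonoid s (Q : 'M[int]_(s, r))
    (H : set (Kstar K)) :
  finite_submonoid H -> finite_submonoid (parameterized_set phi Q H).
Proof.
move=> [finH [H1 HM]]; split; first exact/finite_image/finite_torus_box.
split=> [|_ _ /set_mem[t Ht <-] /set_mem[t' Ht' <-]]; apply/mem_set.
  exists 1%g => [k /=|]; last by rewrite monomial_map1.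
  by rewrite ffunE; exact/set_mem.
exists (t * t')%g => [k /=|]; last by rewrite monomial_mapM torus_classM.
by rewrite ffunE; apply/set_mem/HM; apply/mem_set.
Qed.

End ToricTorusLemmas.

Theorem theorem3p2 (R : realType) (K : fieldType) (n r : nat)
    (Sigma : set (set 'rV[R]_n)) (phi : 'M[int]_(r, n))
    (A : zmodType) (beta : {additive 'cV[int]_r -> A})
    (hfan : is_fan Sigma)
    (hcomplete : complete_fan Sigma)
    (hsimplicial : simplicial_fan Sigma)
    (hrays : ray_generators Sigma phi)
    (hexact : class_group_sequence phi beta)
    (htorsion : torsion_order_coprime_pchar A K)
    (hsplit : range (@monomial_map K r n phi) = setT)
    (hK : finite_set [set: K] \/ GRing.closed_field_axiom K)
    (Y : set (TX K phi)) :
  finite_submonoid Y <->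
  exists H : set (Kstar K), finite_submonoid H /\
    exists (s : nat) (Q : 'M[int]_(s, r)), Y = parameterized_set phi Q H.
Proof.
split=> [subY|[H [subH [s [Q ->]]]]]; last exact: parameterized_set_finite_submonoid.
have [/finite_seqP[l Yl] closedY] := subY.
have /choice[f fP] : forall y, exists P : torus K r, Y y ->
    torus_class phi P = y /\
    forall j, exists2 m, (0 < m)%N & val (P j) ^+ m = 1.
  move=> y; have [Yy|nYy] := pselect (Y y); last by exists 1%g.
  by have [P] := torsion_representative _ _ _ _ _ _ hK (cgs_inj hexact) subY Yy; exists P.
have Y_nth (k : 'I_(size l)) : Y (nth 1%g l k) by rewrite Yl /= mem_nth.
pose P (k : 'I_(size l)) := f (nth 1%g l k).
have P_class k : torus_class phi (P k) = nth 1%g l k by case: (fP _ (Y_nth k)).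
have [|N [h [prim_h hN]]] :=
    common_primitive_root _ [seq val (P k j) | k <- enum 'I_(size l), j <- enum 'I_r].
  by move=> _ /allpairsP[[k j] [_ _ ->]]; case: (fP _ (Y_nth k)).
have /choice[q qE] : forall kj, exists q : nat, val (P kj.1 kj.2) = h ^+ q.
  move=> [k j]; have [|q qE] := prim_rootP prim_h (x := val (P k j)).
    by apply/hN/allpairsP; exists (k, j); rewrite !mem_enum.
  by exists q.
pose Q : 'M[int]_(size l, r) := \matrix_(k, j) (q (k, j))%:Z.
have valQ (t : torus K (size l)) j :
    val (monomial_map Q t j) = \prod_k val (t k) ^+ q (k, j).
  by rewrite ffunE /=; apply: eq_bigr => k _; rewrite !mxE.
pose H : set (Kstar K) := [set x | val x ^+ N = 1].
have h_neq0 : h != 0.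
  by rewrite (prim_root_eq0 prim_h) -lt0n (prim_order_gt0 prim_h).
pose g : Kstar K := Sub h h_neq0.
exists H; split; first exact: (roots_of_unity_finite_submonoid _ _ g).
(* The rows of [Q] run through all of [Y], so that each element of [Y] is reached
   by setting a single parameter to [h] and the others to 1. *)
exists (size l), Q; apply/seteqP; split=> [y Yy|_ [t Ht <-]].
  have yl : (index y l < size l)%N by rewrite index_mem; move: Yy; rewrite Yl.
  pose k := Ordinal yl.
  exists [ffun i => if i == k then g else 1%g].
    move=> i; rewrite /H /= ffunE; case: (i == k); last exact: expr1n.
    exact: prim_expr_order.
  have -> : y = torus_class phi (P k).
    by rewrite P_class nth_index // -index_mem.
  congr torus_class; apply/ffunP => j; apply: val_inj; rewrite valQ.
  rewrite (bigD1 k) //= big1 => [|i ik]; rewrite ffunE ?eqxx.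
    by rewrite mulr1 (qE (k, j)).
  by rewrite (negPf ik) expr1n.
have /choice[a aE] : forall k, exists a : nat, val (t k) = h ^+ a.
  by move=> k; have [i tki] := prim_rootP prim_h (Ht k); exists i.
(* In exponents, [h ^ (a_k * q_kj)] is the coordinate of [P_k ^ a_k]. *)
have -> : monomial_map Q t = (\prod_k P k ^+ a k)%g.
  apply/ffunP => j; apply: val_inj; rewrite valQ torus_prodE.
  apply: eq_bigr => k _.
  by rewrite torus_expgE (qE (k, j)) aE -!exprM mulnC.
elim/big_ind: _ => [|X X' YX YX'|k _].
- by case: closedY => /set_mem.
- by rewrite torus_classM; case: closedY => _ YM; apply/set_mem/YM; apply/mem_set.
by rewrite torus_classX P_class; exact: submonoid_expg.
Qed.
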